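(* Let $\mathcal M$ be an instance of the MIM problem on the graph $G=(V,E)$, with arbitrary activation functions, and let $v\in V$. For each $S\subseteq V$, \[\mathbb E[\underline g(S,\mathcal R_v)]\ \le\ \mathbb E[g(S,\mathcal R_v)]\ =\ f_v(S)\ \le\ \mathbb E[\overline g(S,\mathcal R_v)],\] where $\mathcal R_v$ is a random RR-tuple of $v$ and $f_v(S)$ is the probability that $v$ is $c_{new}$-active at the end of the diffusion when $S$ is the seed set of $c_{new}$.
   Context: Independent Multi-Cascade (IMC) model. A social network is a finite directed graph $G=(V,E)$ with $n=|V|$, $m=|E|$; each edge $(u,v)$ has a propagation probability $p_{(u,v)}\in(0,1]$. $C$ is a finite set of cascades; each $c\in C$ has a seed set $\tau(c)\subseteq V$. Each node is either inactive or $c$-active for exactly one $c\in C$, and once active it never changes state. Let $\pi_t(v)$ be the state of $v$ at step $t$. Each node $v$ has an activation function $F_v:2^{V\times C}\to C$ (needed only on the inputs that can arise) such that: (a) if $v$ is a seed of exactly the cascades in a nonempty $C'\subseteq C$, then at step 0 $v$ becomes $F_v(O)$-active with $O=\{(v,c):c\in C'\}$, and $F_v(O)\in C'$; (b) if $v$ is for the first time successfully activated at step $t$, by exactly the set $A$ of in-neighbors, then $v$ becomes $F_v(O)$-active with $O=\{(u,\pi_{t-1}(u)):u\in A\}$, and $F_v(O)\in\{\pi_{t-1}(u):u\in A\}$. Diffusion: at step 0 seeds are activated by (a), other nodes are inactive. At step $t\ge1$ each node $u$ activated at step $t-1$ makes one independent attempt to activate each inactive out-neighbor $v$, succeeding with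 probability $p_{(u,v)}$; nodes with at least one success are activated by (b). The process ends when no further activation is possible. MIM instance $\mathcal M$: a finite directed graph $G=(V,E)$ with propagation probabilities $p_{(u,v)}\in(0,1]$ on its edges, existing cascades $C_e=\{c_1,\dots,c_L\}$ with known seed sets $\tau(c_i)$, a new cascade $c_{new}$, $C=C_e\cup\{c_{new}\}$, activation functions $F_v$ over $C$, a candidate set $V_c\subseteq V$, and $k\in\mathbb{Z}^+$ (the last two play no role here). RR-tuple of $v$ (random). Let $\tau^*=\bigcup_{c\in C_e}\tau(c)$. Start with $V(G_v)=\{v\}$, $E(G_v)=\emptyset$, $V_t=\{v\}$, $\overline S_v=\underline S_v=\emptyset$, and repeat: (i) if $V_t=\emptyset$, return; (ii) if $V_t\cap\tau^*\ne\emptyset$, set $\overline S_v\leftarrow\overline S_v\cup V_t$ and return; (iii) otherwise add $V_t$ to both $\overline S_v$ and $\underline S_v$, let $V_r=V\setminus V(G_v)$ and $E^*=\{(u_1,u_2)\in E:u_1\in V_r,u_2\in V_t\}$, reset $V_t=\emptyset$, and for each $(u_1,u_2)\in E^*$, independently with probability $p_{(u_1,u_2)}$, add $u_1$ to $V_t$ and to $V(G_v)$ and add $(u_1,u_2)$ to $E(G_v)$. The output is $R_v=(G_v,\underline S_v,\overline S_v)$; $\mathcal R_v$ denotes the random output. For an RR-tuple $R_v$, let $\mathcal M_{R_v}$ be the MIM instance on $G_v$ where each $c\in C_e$ has seed set $V(G_v)\cap\tau(c)$, all edge probabilities are 1, and activation functions are as in $\mathcal M$. Define $g(S,R_v)=1$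 if $v$ is $c_{new}$-active in $\mathcal M_{R_v}$ when $c_{new}$ has seed set $S$ (i.e. $S\cap V(G_v)$), else $0$; $\overline g(S,R_v)=1$ if $S\cap\overline S_v\ne\emptyset$, else $0$; $\underline g(S,R_v)=1$ if $S\cap\underline S_v\ne\emptyset$, else $0$. *)

(* Defs.v *)
From HB Require Import structures.
From mathcomp Require Import all_boot all_order all_algebra.

Set Implicit Arguments.
Unset Strict Implicit.
Unset Printing Implicit Defensive.

Import Order.TTheory GRing.Theory Num.Theory.
Local Open Scope ring_scope.

(* Laws on a finite type are given by their probability mass functions. *)
Section FiniteLaws.
Variable R : realFieldType.

Definition law (T : finType) := {ffun T -> R}.

Definition dret (T : finType) (x : T) : law T := [ffun y => (x == y)%:R].

Definition dbind (T U : finType) (d : law T) (k : T -> law U) : law U :=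
  [ffun y => \sum_x d x * k x y].

Definition prob (T : finType) (d : law T) (P : pred T) : R := \sum_(x | P x) d x.

Definition expect (T : finType) (d : law T) (h : T -> R) : R :=
  \sum_x d x * h x.

(* The random subset of D that contains each e in D independently with        *)
(* probability p e.                                                           *)
Definition coins (T : finType) (p : T -> R) (D : {set T}) : law {set T} :=
  [ffun X : {set T} => if X \subset D
    then (\prod_(e in X) p e) * (\prod_(e in D :\: X) (1 - p e)) else 0].

Lemma coins_sum1 (T : finType) (p : T -> R) (D : {set T}) :
  \sum_X coins p D X = 1.
Proof.
pose F e (b : bool) : R := if e \in D then if b then p e else 1 - p e
                           else if b then 0 else 1.
have -> : 1 = \prod_e \sum_(b : bool) F e b.
  rewrite big1 // => e _; rewrite big_bool /F.
  by case: ifP => _ /=; [rewrite addrC subrK | rewrite add0r].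
rewrite bigA_distr_bigA (reindex (fun X : {set T} => [ffun e => e \in X])) /=.
  apply: eq_bigr => X _; rewrite ffunE; case: ifPn => [sXD|/subsetPn[e eX eD]].
    rewrite [RHS](bigID (mem D)) /= [X in _ = _ * X]big1 ?mulr1; last first.
      by move=> e eD; rewrite ffunE /F (negPf eD); case: ifP => // eX;
        rewrite (subsetP sXD) in eD.
    rewrite [RHS](bigID (mem X)) /=; congr (_ * _).
      rewrite [RHS](eq_bigl (mem X)) => [|e /=].
        by apply: eq_bigr => e eX; rewrite ffunE /F (subsetP sXD _ eX) eX.
      by case eX: (e \in X); rewrite ?andbT ?andbF // (subsetP sXD _ eX).
    rewrite (eq_bigl (fun e => (e \in D) && (e \notin X))) => [|e]; last first.
      by rewrite inE andbC.
    by apply: eq_bigr => e /andP[eD eX]; rewrite ffunE /F eD (negPf eX).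
  by rewrite (bigD1 e) //= ffunE /F (negPf eD) eX mul0r.
exists (fun h : {ffun T -> bool} => [set e | h e]) => [X _|h _].
  by apply/setP => e; rewrite inE ffunE.
by apply/ffunP => e; rewrite ffunE inE.
Qed.

Lemma coins_supp (T : finType) (p : T -> R) (D X : {set T}) :
  coins p D X != 0 -> X \subset D.
Proof. by rewrite ffunE; case: ifP => //; rewrite eqxx. Qed.

Lemma coins1 (T : finType) (D : {set T}) : coins (fun=> 1) D = dret D.
Proof.
apply/ffunP => X; rewrite !ffunE; case: (D =P X) => [<-|nDX].
  by rewrite subxx setDv big_set0 mulr1 big1.
case: ifP => // sXD; have /set0Pn[e eDX] : D :\: X != set0.
  by apply/eqP => /eqP; rewrite setD_eq0 => sDX; case: nDX; apply/eqP;
    rewrite eqEsubset sDX sXD.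
by rewrite [X in _ * X](bigD1 e) //= subrr mul0r mulr0.
Qed.

Lemma dbind_ret (T U : finType) (x : T) (k : T -> law U) :
  dbind (dret x) k = k x.
Proof.
apply/ffunP => y; rewrite ffunE (bigD1 x) //= ffunE eqxx mul1r big1 ?addr0 //.
by move=> z zx; rewrite ffunE eq_sym (negPf zx) mul0r.
Qed.

Lemma dbind_supp (T U : finType) (d : law T) (k : T -> law U) y :
  dbind d k y != 0 -> exists2 x, d x != 0 & k x y != 0.
Proof.
rewrite ffunE => nz; have [x /andP[dx kx]|none] :=
  pickP (fun x => (d x != 0) && (k x y != 0)); first by exists x.
case/eqP: nz; rewrite big1 // => x _; apply/eqP; rewrite mulf_eq0.
by apply: contraFT (none x); rewrite negb_or.
Qed.

Lemma dret_supp (T : finType) (x y : T) : dret x y != 0 -> y = x.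
Proof. by rewrite ffunE; case: (x =P y) => // _; rewrite eqxx. Qed.

End FiniteLaws.

(* Self-loops are allowed; they are inert, since attempts only target         *)
(* inactive nodes.                                                            *)
Record imc (R : realFieldType) (V C : finType) := IMC {
  edges : {set V * V};
  pprob : V * V -> R;
  actf : V -> {set V * C} -> C
}.

Section Diffusion.
Variables (R : realFieldType) (V C : finType) (N : imc R V C).

Definition pprob_valid : Prop :=
  forall e, e \in edges N -> 0 < pprob N e <= 1.

(* Constraints only on the inputs of the activation functions that can arise; *)
(* w \notin A because a node attempted by A is inactive.                      *)
Definition actf_valid : Prop :=
  (forall (w : V) (C' : {set C}), C' != set0 ->
     actf N w [set (w, c) | c in C'] \in C')
  /\
  (forall (w : V) (A : {set V}) (pi : V -> C),
     A != set0 -> w \notin A -> (forall u, u \in A -> (u, w) \in edges N) ->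
     actf N w [set (u, pi u) | u in A] \in [set pi u | u in A]).

(* Node states (None = inactive), together with the set of the nodes that     *)
(* were activated at the current step.                                        *)
Definition state : finType := {ffun V -> option C}.
Definition config : finType := (state * {set V})%type.

Definition seeded (tau : C -> {set V}) (w : V) : {set C} :=
  [set c | w \in tau c].

Definition init_config (tau : C -> {set V}) : config :=
  ([ffun w => if seeded tau w == set0 then None
              else Some (actf N w [set (w, c) | c in seeded tau w])],
   [set w | seeded tau w != set0]).

Definition attempts (x : config) : {set V * V} :=
  [set e in edges N | (e.1 \in x.2) && (x.1 e.2 == None)].

Definition activators (X : {set V * V}) (w : V) : {set V} :=
  [set u | (u, w) \in X].

Definition update (x : config) (X : {set V * V}) : config :=
  ([ffun w => if activators X w == set0 then x.1 w
              else Some (actf N w [set uc : V * C |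
                     (uc.1 \in activators X w) && (x.1 uc.1 == Some uc.2)])],
   [set w | activators X w != set0]).

Definition step (x : config) : law R config :=
  dbind (coins (pprob N) (attempts x)) (fun X => dret R (update x X)).

Fixpoint diffusion (tau : C -> {set V}) (t : nat) : law R config :=
  if t is t'.+1 then dbind (diffusion tau t') step
  else dret R (init_config tau).

(* Every step before the end activates a node, so the process has ended after *)
(* #|V| steps: see final_ended.                                               *)
Definition final (tau : C -> {set V}) : law R config := diffusion tau #|V|.

Definition active (x : config) : {set V} := [set w | x.1 w != None].

Lemma diffusion_supp tau t x : diffusion tau t x != 0 ->
  x.2 != set0 -> (t < #|active x|)%N.
Proof.
elim: t x => [|t IHt] x.
  move=> /dret_supp -> /set0Pn[w]; rewrite inE => nw.
  by rewrite card_gt0; apply/set0Pn; exists w; rewrite inE ffunE (negPf nw).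
case/dbind_supp=> y /IHt {}IHt /dbind_supp[X /coins_supp sX /dret_supp ->].
case/set0Pn=> w; rewrite inE => nw; have /set0Pn[u] := nw; rewrite inE => uwX.
have := subsetP sX _ uwX; rewrite !inE /= => /and3P[_ uy2 /eqP yw].
apply: leq_ltn_trans (IHt _) _; first by apply/set0Pn; exists u.
apply: proper_card; apply/properP; split.
  apply/subsetP => z; rewrite !inE ffunE; by case: ifP.
exists w; first by rewrite inE ffunE (negPf nw).
by rewrite inE yw.
Qed.

Lemma final_ended tau x : final tau x != 0 -> x.2 = set0.
Proof.
move=> /diffusion_supp sx; apply/eqP/negPn/negP => /sx.
by rewrite ltnNge max_card.
Qed.

End Diffusion.

(* The cascades are option Ce: Some i is the existing cascade i, None (cnew)  *)
(* is c_new. The candidate set and the budget of an instance are omitted.     *)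
Record mim (R : realFieldType) (V Ce : finType) := MIM {
  network :> imc R V (option Ce);
  eseeds : Ce -> {set V}
}.

(* RR-tuples of a node: the vertices and the edges of G_v, then the sets      *)
(* \underline S_v and \overline S_v.                                          *)
Record rrtuple (V : finType) := RRtuple {
  rrV : {set V};
  rrE : {set V * V};
  rr_lower : {set V};
  rr_upper : {set V}
}.

Section RRtupleFinite.
Variable V : finType.
Definition rr_encode (r : rrtuple V) :=
  (rrV r, rrE r, rr_lower r, rr_upper r).
Definition rr_decode (x : {set V} * {set V * V} * {set V} * {set V}) :=
  let: (a, b, c, d) := x in RRtuple a b c d.
Lemma rr_encodeK : cancel rr_encode rr_decode. Proof. by case. Qed.
HB.instance Definition _ := Finite.copy (rrtuple V) (can_type rr_encodeK).
End RRtupleFinite.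

Section MIM.
Variables (R : realFieldType) (V Ce : finType) (M : mim R V Ce).

Definition mim_valid : Prop := pprob_valid M /\ actf_valid M.

Definition seeding (S : {set V}) (c : option Ce) : {set V} :=
  if c is Some i then eseeds M i else S.

Definition cnew : option Ce := None.

Definition cnew_active (v : V) : pred (config V (option Ce)) :=
  fun x => x.1 v == Some cnew.

Definition f (v : V) (S : {set V}) : R :=
  prob (final M (seeding S)) (cnew_active v).

Definition tau_star : {set V} := \bigcup_i eseeds M i.

(* On exhausted fuel the current tuple is returned; fuel #|V|.+1 is never     *)
(* exhausted: see rr_loop_fuel.                                               *)
Fixpoint rr_loop (fuel : nat) (VG : {set V}) (EG : {set V * V})
    (Vt Slo Sup : {set V}) : law R (rrtuple V) :=
  if fuel is fuel'.+1 then
    if Vt == set0 then dret R (RRtuple VG EG Slo Sup)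
    else if Vt :&: tau_star != set0 then
      dret R (RRtuple VG EG Slo (Sup :|: Vt))
    else
      dbind (coins (pprob M)
               [set e in edges M | (e.1 \in ~: VG) && (e.2 \in Vt)])
        (fun X => let Vt' := [set e.1 | e in X] in
           rr_loop fuel' (VG :|: Vt') (EG :|: X) Vt' (Slo :|: Vt) (Sup :|: Vt))
  else dret R (RRtuple VG EG Slo Sup).

Definition rr_law (v : V) : law R (rrtuple V) :=
  rr_loop #|V|.+1 [set v] set0 [set v] set0 set0.

Lemma rr_loop_fuelS n VG EG Vt Slo Sup : (#|~: VG| + (Vt != set0) < n)%N ->
  rr_loop n.+1 VG EG Vt Slo Sup = rr_loop n VG EG Vt Slo Sup.
Proof.
elim: n VG EG Vt Slo Sup => // n IHn VG EG Vt Slo Sup lt_n.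
rewrite /=; case: ifP => // Vt0; case: ifP => // _.
apply/ffunP => r; rewrite !ffunE; apply: eq_bigr => X _.
have [->|/coins_supp sX] := eqVneq (coins (pprob M)
  [set e in edges M | (e.1 \in ~: VG) && (e.2 \in Vt)] X) 0.
  by rewrite !mul0r.
congr (_ * _); apply: (congr1 (fun d : law R (rrtuple V) => d r)).
apply: IHn.
rewrite Vt0 addn1 ltnS in lt_n; apply: leq_ltn_trans lt_n.
set W := [set e.1 | e in X].
have sW : W \subset ~: VG.
  by apply/subsetP => _ /imsetP[e eX ->]; have := subsetP sX _ eX;
    rewrite !inE => /and3P[].
have := cardsID W (~: VG); rewrite (setIidPr sW) setCU setDE => <-.
by rewrite addnC leq_add2r; case: eqP => // /eqP; rewrite card_gt0.
Qed.

Lemma rr_loop_fuel n v : (#|V| < n)%N ->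
  rr_loop n [set v] set0 [set v] set0 set0 = rr_law v.
Proof.
elim: n => // n IHn; rewrite ltnS leq_eqVlt => /predU1P[<- //|lt_n].
rewrite rr_loop_fuelS ?IHn //; apply: leq_ltn_trans lt_n.
by rewrite -(cardsC [set v]) cards1 addnC leq_add2r leq_b1.
Qed.

(* The instance on G_v, kept on the node type V: the nodes outside V(G_v) are *)
(* neither seeds nor incident to an edge, so they stay inactive.              *)
Definition mim_of_rr (r : rrtuple V) : mim R V Ce :=
  MIM (IMC (rrE r) (fun=> 1) (actf M)) (fun i => rrV r :&: eseeds M i).

End MIM.

Section Estimators.
Variables (R : realFieldType) (V Ce : finType).

(* With unit propagation probabilities the diffusion is deterministic, so     *)
(* "v is c_new-active" has probability 0 or 1: see g_deterministic.           *)
Definition g (M : mim R V Ce) (v : V) (S : {set V}) (r : rrtuple V) : R :=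
  (f (mim_of_rr M r) v (S :&: rrV r) == 1)%:R.

Lemma g_deterministic M v S r :
  g M v S r = f (mim_of_rr M r) v (S :&: rrV r).
Proof.
have [x fx] : exists x,
    final (mim_of_rr M r) (seeding (mim_of_rr M r) (S :&: rrV r)) = dret R x.
  rewrite /final; elim: #|V| => [|t [y /= ->]]; first by eexists.
  by eexists; rewrite dbind_ret /step /= coins1 dbind_ret.
rewrite /g /f fx /prob; case: (boolP (cnew_active v x)) => vx.
  rewrite (bigD1 x) //= ffunE eqxx big1 ?addr0 ?eqxx // => y /andP[_ yx].
  by rewrite ffunE eq_sym (negPf yx).
rewrite big1 ?(eq_sym 0) ?oner_eq0 // => y vy; rewrite ffunE.
by case: eqP vx => // ->; rewrite vy.
Qed.

Definition g_lower (S : {set V}) (r : rrtuple V) : R :=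
  (S :&: rr_lower r != set0)%:R.

Definition g_upper (S : {set V}) (r : rrtuple V) : R :=
  (S :&: rr_upper r != set0)%:R.

End Estimators.

(* Main.v *)
(* Flip the coins of all edges in advance and let X be the set of live edges: *)
(* neither the diffusion nor the construction of the RR-tuple looks at an     *)
(* edge twice, so both become deterministic functions of X. Let L_i be the    *)
(* set of the nodes at distance i to v in X, and k the least i such that L_i  *)
(* contains a seed. Nothing can activate v before step k, so its state at     *)
(* step k depends only on the states at step t of the nodes of L_(k - t); the *)
(* edges that carry this influence go from L_(i+1) to L_i and are kept in the *)
(* RR-tuple, whence the equality. The RR-tuple stops at the first layer d >=  *)
(* k meeting an existing seed set. If S meets some L_i with i < d, then all   *)
(* the seeds in L_k are seeds of c_new, which wins v; conversely v can only   *)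
(* be won by c_new if S meets L_k.                                            *)

Require Import Defs.
From mathcomp Require Import all_boot all_order all_algebra.
From mathcomp Require Import zify.
Import Order.TTheory GRing.Theory Num.Theory.
Local Open Scope ring_scope.

Set Implicit Arguments.
Unset Strict Implicit.
Unset Printing Implicit Defensive.

(** The relations already hold for each fixed live-edge set [X] ([live_estimates]), and averaging
    over [X] gives the theorem. Diffusion and RR construction are adaptive explorations without
    repeated queries, so [iter_reveal] writes both expectations over the same coins
    ([expect_diffusion], [expect_rr_law]). For fixed [X], [live_eq] makes the diffusions on the
    graph and on the RR-tuple agree at [v] at time [k]; [live_reach] says that a seed in layer [k]
    gets [v] activated, and [live_source] that the winner has a seed in that layer. If [v] is active
    at time [k], its state is final; otherwise [k] is [#|V|], the last time considered. *)

Section Coins.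
Variables (R : realFieldType) (T : finType) (p : T -> R).
Implicit Types (D X Y : {set T}).

Lemma coinsE D X : X \subset D ->
  coins p D X = \prod_(e in D) (if e \in X then p e else 1 - p e).
Proof.
move=> sXD; rewrite ffunE sXD [RHS](big_setID X) /= (setIidPr sXD).
congr (_ * _); apply: eq_bigr => e; first by move->.
by rewrite inE => /andP[/negPf->].
Qed.

Lemma coins_ge0 D X : (forall e, e \in D -> 0 <= p e <= 1) -> 0 <= coins p D X.
Proof.
move=> p01; have [sXD|nXD] := boolP (X \subset D); last first.
  by rewrite ffunE (negPf nXD).
rewrite coinsE //; apply: prodr_ge0 => e /p01/andP[p0 p1].
by case: ifP; rewrite ?subr_ge0.
Qed.

(** Independence of the coins in [D1] from the others: [X] corresponds to the pair of its traces on
    [D1] and on [D :\: D1], and the weights multiply. *)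
Lemma coins_split D1 D (h : {set T} -> R) : D1 \subset D ->
  \sum_X coins p D X * h X =
  \sum_X1 coins p D1 X1 * \sum_X2 coins p (D :\: D1) X2 * h (X1 :|: X2).
Proof.
move=> sD1.
have supp D' (k : {set T} -> R) :
    \sum_X coins p D' X * k X = \sum_(X : {set T} | X \subset D') coins p D' X * k X.
  rewrite [LHS](bigID (fun X : {set T} => X \subset D')) /=.
  rewrite [X in _ + X]big1 ?addr0 //.
  by move=> X /negPf nX; rewrite ffunE nX mul0r.
rewrite supp [RHS]supp.
under [RHS]eq_bigr do rewrite supp big_distrr /=.
rewrite pair_big_dep /=.
rewrite (reindex_onto (fun q : {set T} * {set T} => q.1 :|: q.2)
                      (fun X : {set T} => (X :&: D1, X :\: D1))) /=; last first.
  by move=> X _; rewrite setID.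
apply: eq_big => [[X1 X2]|[X1 X2]] /=.
  apply/andP/andP => [[sX /eqP[e1 e2]]|[sX1 sX2]].
    by split; [rewrite -e1 subsetIr | rewrite -e2 setSD].
  have dX2 : X2 :&: D1 = set0.
    by apply/setP => e; rewrite !inE; apply/negP => /andP[/(subsetP sX2)];
      rewrite inE => /andP[/negPf->].
  split.
    rewrite subUset (subset_trans sX1 sD1).
    exact: subset_trans sX2 (subsetDl _ _).
  rewrite setIUl dX2 setU0 (setIidPl sX1) setDUl.
  have /eqP-> : X1 :\: D1 == set0 by rewrite setD_eq0.
  by rewrite set0U setDE; move: sX2; rewrite subsetD => /andP[_];
    rewrite -setDE => /setDidPl->.
case/andP=> sX /eqP[e1 e2].
rewrite mulrA; congr (_ * _).
have sX1 : X1 \subset D1 by rewrite -e1 subsetIr.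
have sX2 : X2 \subset D :\: D1 by rewrite -e2 setSD.
rewrite !coinsE // (big_setID D1) /= (setIidPr sD1); congr (_ * _).
  by apply: eq_bigr => e eD1; rewrite -[in RHS]e1 [e \in _ :&: _]inE eD1 andbT.
apply: eq_bigr => e; rewrite inE => /andP[eD1 _].
by rewrite -[in RHS]e2 [e \in _ :\: _]inE eD1.
Qed.

End Coins.

(** * Adaptive exploration and deferred decisions *)

Section Exploration.
Variables (R : realFieldType) (T : finType) (Q : Type) (p : T -> R).
Variables (query : Q -> {set T}) (next : Q -> {set T} -> Q).
Implicit Types (x : Q) (D X Y : {set T}).

(** One round as an operator on test functions: [iter t reveal h x] is the expected value of [h]
    after [t] rounds from [x]. *)
Definition reveal (h : Q -> R) (x : Q) : R :=
  \sum_X coins p (query x) X * h (next x X).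

Definition live_step (X : {set T}) (x : Q) : Q := next x (X :&: query x).

(* [inv x D] says that all present and future queries from [x] lie in [D].    *)
Variable inv : Q -> {set T} -> Prop.
Hypothesis inv_query : forall x D, inv x D -> query x \subset D.
Hypothesis inv_next : forall x D X, inv x D -> X \subset query x ->
  inv (next x X) (D :\: query x).

Lemma live_local t x D X Y : inv x D -> X :&: D = Y :&: D ->
  iter t (live_step X) x = iter t (live_step Y) x.
Proof.
elim: t x D => // t IHt x D xD eXY; rewrite !iterSr.
have sq := inv_query xD.
have -> : live_step X x = live_step Y x.
  by congr next; rewrite -(setIidPr sq) !setIA eXY.
apply: IHt (inv_next xD (subsetIr _ _)) _.
by rewrite !setDE !setIA eXY.
Qed.

(* Deferred decisions: no element is queried twice, so all the coins may be   *)
(* flipped in advance.                                                        *)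
Lemma iter_reveal t h x D : inv x D ->
  iter t reveal h x = \sum_X coins p D X * h (iter t (live_step X) x).
Proof.
elim: t x D => [|t IHt] x D xD; first by rewrite /= -mulr_suml coins_sum1 mul1r.
rewrite iterS /reveal (coins_split _ _ (inv_query xD)).
apply: eq_bigr => X1 _.
have [->|/coins_supp sX1] := eqVneq (coins p (query x) X1) 0; first by rewrite !mul0r.
rewrite (IHt _ _ (inv_next xD sX1)); congr (_ * _); apply: eq_bigr => X2 _.
have [->|/coins_supp sX2] := eqVneq (coins p (D :\: query x) X2) 0.
  by rewrite !mul0r.
have dX2 : X2 :&: query x = set0.
  by apply/eqP; rewrite setI_eq0; move: sX2; rewrite subsetD => /andP[].
congr (_ * h _); rewrite iterSr.
have -> : live_step (X1 :|: X2) x = next x X1.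
  by rewrite /live_step setIUl dX2 setU0 (setIidPl sX1).
apply: live_local (inv_next xD sX1) _.
rewrite setIUl [X1 :&: _](_ : _ = set0) ?set0U //.
apply/setP => e; rewrite !inE; apply/negP => /and3P[/(subsetP sX1)->] //.
Qed.

End Exploration.

Lemma expect_bind (R : realFieldType) (T U : finType) (d : law R T)
    (k : T -> law R U) (h : U -> R) :
  expect (dbind d k) h = expect d (fun x => expect (k x) h).
Proof.
rewrite /expect; under eq_bigr do rewrite ffunE big_distrl /=.
rewrite exchange_big; apply: eq_bigr => x _; rewrite big_distrr /=.
by apply: eq_bigr => y _; rewrite mulrA.
Qed.

Lemma expect_ret (R : realFieldType) (T : finType) (x : T) (h : T -> R) :
  expect (dret R x) h = h x.
Proof.
rewrite /expect (bigD1 x) //= ffunE eqxx mul1r big1 ?addr0 // => y yx.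
by rewrite ffunE eq_sym (negPf yx) mul0r.
Qed.

(** * Diffusion on a fixed set of live edges *)

Section LiveDiffusion.
Variables (R : realFieldType) (V C : finType) (N : imc R V C).
Implicit Types (x : config V C) (D X : {set V * V}) (tau : C -> {set V}).

Definition live_config (tau : C -> {set V}) (X : {set V * V}) (t : nat) :=
  iter t (live_step (attempts N) (update N) X) (init_config N tau).

Definition diffusion_inv (x : config V C) (D : {set V * V}) : Prop :=
  x.2 \subset active x /\
  forall e, e \in edges N -> x.1 e.2 = None ->
    (e.1 \in x.2) || (x.1 e.1 == None) -> e \in D.

Lemma diffusion_inv_query x D : diffusion_inv x D -> attempts N x \subset D.
Proof.
case=> _ xD; apply/subsetP => e; rewrite inE => /and3P[eE e1 /eqP e2].
by apply: xD; rewrite ?e1.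
Qed.

Lemma update_None x X w : (update N x X).1 w = None -> x.1 w = None.
Proof. by rewrite ffunE; case: ifP. Qed.

(** The tail of an attempted edge is active and leaves the front for good, since only inactive nodes
    join the front; hence no edge is attempted twice. *)
Lemma diffusion_inv_next x D X : diffusion_inv x D -> X \subset attempts N x ->
  diffusion_inv (update N x X) (D :\: attempts N x).
Proof.
case=> xa xD sX; split.
  by apply/subsetP => w; rewrite !inE ffunE => /negPf->.
move=> e eE /update_None e2 He.
have e1 : x.1 e.1 = None.
  case/orP: He => [|/eqP /update_None //].
  rewrite inE => /set0Pn[u]; rewrite inE => /(subsetP sX).
  by rewrite inE => /and3P[_ _ /eqP].
rewrite inE xD ?e1 ?eqxx ?orbT // inE eE e2 !andbT.
by apply/negP => /(subsetP xa); rewrite inE e1.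
Qed.

Lemma expect_diffusion tau t h :
  expect (diffusion N tau t) h =
  \sum_X coins (pprob N) (edges N) X * h (live_config tau X t).
Proof.
transitivity (iter t (reveal (pprob N) (attempts N) (update N)) h
                (init_config N tau)).
  elim: t h => [|t IHt] h; first exact: expect_ret.
  rewrite iterSr -IHt /= expect_bind; apply: eq_bigr => x _; congr (_ * _).
  by rewrite expect_bind; apply: eq_bigr => X _; rewrite expect_ret.
rewrite (iter_reveal (pprob N) diffusion_inv_query diffusion_inv_next _ _
  (D := edges N)) //.
split=> //.
by apply/subsetP => w; rewrite !inE ffunE => /negPf->.
Qed.

Lemma prob_final tau (P : pred (config V C)) :
  prob (final N tau) P =
  \sum_X coins (pprob N) (edges N) X * (P (live_config tau X #|V|))%:R.
Proof.
rewrite -(expect_diffusion tau #|V| (fun x => (P x)%:R)) /prob big_mkcond.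
by apply: eq_bigr => x _; case: (P x); rewrite (mulr1, mulr0).
Qed.

Lemma live_configS tau X t :
  live_config tau X t.+1 =
  update N (live_config tau X t) (X :&: attempts N (live_config tau X t)).
Proof. by []. Qed.

Lemma front_active tau X t :
  (live_config tau X t).2 \subset active (live_config tau X t).
Proof.
case: t => [|t]; first by apply/subsetP => w; rewrite !inE ffunE => /negPf->.
by apply/subsetP => w; rewrite live_configS !inE ffunE => /negPf->.
Qed.

Lemma live_config_persist tau X t w : (live_config tau X t).1 w != None ->
  forall t', (t <= t')%N ->
  (live_config tau X t').1 w = (live_config tau X t).1 w.
Proof.
move=> wt t' /subnK <-; elim: (t' - t)%N => // s IHs.
rewrite addSn live_configS ffunE -IHs ifT //; apply/eqP/setP => u.
rewrite !inE; apply/negP => /and4P[_ _ _ /=].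
by rewrite IHs (negPf wt).
Qed.

End LiveDiffusion.

(* [L] stands for the backward distance layers of a node [v], and [k] for the *)
(* first layer with a seed. At time [t] the front can affect [v] at time [k]  *)
(* only through layer [k - t].                                                *)
Section Layers.
Variables (R : realFieldType) (V C : finType) (N : imc R V C).
Variables (tau : C -> {set V}) (X : {set V * V}) (L : nat -> {set V}) (k : nat).
Hypothesis sub_edges : X \subset edges N.
Hypothesis layer_back : forall j u w, (j < k)%N -> w \in L j -> (u, w) \in X ->
  exists2 i, (i <= j.+1)%N & u \in L i.
Hypothesis seedless : forall i w, (i < k)%N -> w \in L i -> seeded tau w = set0.

Let x t := live_config N tau X t.

(** Influence crosses one edge per step, and an edge lowers the layer index by at most one. *)
Lemma live_inactive t i w : (i + t < k)%N -> w \in L i -> (x t).1 w = None.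
Proof.
elim: t i w => [|t IHt] i w lt_k wL.
  by rewrite /x /= ffunE (seedless _ wL) ?eqxx //; lia.
rewrite /x live_configS ffunE ifT; first by apply: IHt wL; lia.
apply/eqP/setP => u; rewrite !inE; apply/negP => /and4P[uw _ /= ux _].
have [|i' le_i' uL] := layer_back _ wL uw; first by lia.
have := subsetP (front_active N tau X t) _ ux.
by rewrite inE (IHt i') //; lia.
Qed.

Lemma live_front t i w : (i + t = k)%N -> w \in L i ->
  (w \in (x t).2) = ((x t).1 w != None).
Proof.
case: t => [|t] eq_k wL; first by rewrite inE ffunE; case: ifP.
rewrite /x live_configS inE ffunE (@live_inactive t i w) //; last by lia.
by case: ifP.
Qed.

(** In-neighbors in layers below [i.+1] are still inactive at time [t], and active ones in layer
    [i.+1] have only just become active, so all of these attempt [w]. *)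
Lemma live_activators t i w : (i + t.+1 = k)%N -> w \in L i ->
  activators (X :&: attempts N (x t)) w =
  [set u in L i.+1 | ((u, w) \in X) && ((x t).1 u != None)].
Proof.
move=> eq_k wL; apply/setP => u; rewrite !inE /=.
rewrite (live_inactive _ wL) ?eqxx ?andbT; last by lia.
case uw : ((u, w) \in X); last by rewrite andbF.
rewrite (subsetP sub_edges _ uw) /=.
have [uL|uL] /= := boolP (u \in L i.+1); first by apply: live_front uL; lia.
have [|i' le_i' uL'] := layer_back _ wL uw; first by lia.
have {le_i'} lt_i' : (i' < i.+1)%N.
  by rewrite ltn_neqAle le_i' andbT; apply: contraNneq uL => <-.
apply/negP => /(subsetP (front_active N tau X t)).
by rewrite inE (live_inactive _ uL') //; lia.
Qed.

Lemma live_reach i v : (forall j u, (j < k)%N -> u \in L j.+1 ->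
    exists2 w, w \in L j & (u, w) \in X) -> L 0 = [set v] ->
  forall t u, (i + t = k)%N -> u \in L i -> (x t).1 u != None ->
  (x k).1 v != None.
Proof.
move=> layer_fwd L0; elim: i => [|i IHi] t u eq_k uL xu.
  by move: uL; rewrite L0 inE -eq_k => /eqP <-.
have [|w wL uw] := layer_fwd _ _ _ uL; first by lia.
apply: (IHi t.+1 w) => //; first by lia.
rewrite /x live_configS ffunE ifF //; apply/negbTE/set0Pn; exists u.
by rewrite (@live_activators t i w) // ?inE ?uL ?uw //; lia.
Qed.

Lemma live_source t i w c : actf_valid N -> (i + t = k)%N -> w \in L i ->
  (x t).1 w = Some c -> exists2 u, u \in L k & u \in tau c.
Proof.
case=> seed_ok act_ok; elim: t i w c => [|t IHt] i w c eq_k wL.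
  rewrite /x /= ffunE; case: ifP => // /negbT nw [<-].
  exists w; first by rewrite -eq_k addn0.
  by have := seed_ok w _ nw; set c' := actf _ _ _; rewrite inE.
rewrite /x live_configS ffunE (@live_inactive t i w) //; last by lia.
rewrite (@live_activators t i w) //.
set A := [set u in _ | _]; case: ifP => // /negbT nA [].
pose pi u := odflt c ((x t).1 u).
have xA u : u \in A -> (x t).1 u = Some (pi u).
  by rewrite inE => /and3P[_ _]; rewrite /pi; case: ((x t).1 u).
have -> : [set uc : V * C | (uc.1 \in A) && ((x t).1 uc.1 == Some uc.2)] =
          [set (u, pi u) | u in A].
  apply/setP => -[u d]; rewrite inE /=; apply/andP/imsetP.
    by case=> uA /eqP; rewrite xA // => -[<-]; exists u.
  by case=> u' uA [-> ->]; rewrite xA.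
move=> act_c; have : actf N w [set (u, pi u) | u in A] \in [set pi u | u in A].
  (* Validity of the activation function requires [w] outside [A], which holds because [w] is
     inactive while the nodes of [A] are active. *)
  apply: act_ok => // [|u]; last first.
    by rewrite inE => /and3P[_ /(subsetP sub_edges)].
  by rewrite !inE (@live_inactive t i w) ?andbF //; lia.
rewrite act_c => /imsetP[u uA ->].
by apply: (IHt i.+1 u (pi u)); [lia | move: uA; rewrite inE => /and3P[] | apply: xA].
Qed.

End Layers.

(** Only edges between consecutive layers need to agree: by [live_activators] no others matter. This
    permits [X2] to be the edge set of the RR-tuple, which omits live edges. *)
Lemma live_eq (R : realFieldType) (V C : finType) (N1 N2 : imc R V C)
    (tau1 tau2 : C -> {set V}) (X1 X2 : {set V * V}) (L : nat -> {set V}) k :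
  actf N1 = actf N2 -> X1 \subset edges N1 -> X2 \subset edges N2 ->
  (forall j u w, (j < k)%N -> w \in L j -> (u, w) \in X1 ->
     exists2 i, (i <= j.+1)%N & u \in L i) ->
  (forall j u w, (j < k)%N -> w \in L j -> (u, w) \in X2 ->
     exists2 i, (i <= j.+1)%N & u \in L i) ->
  (forall j u w, (j < k)%N -> w \in L j -> u \in L j.+1 ->
     ((u, w) \in X1) = ((u, w) \in X2)) ->
  (forall i w, (i <= k)%N -> w \in L i -> seeded tau1 w = seeded tau2 w) ->
  (forall i w, (i < k)%N -> w \in L i -> seeded tau1 w = set0) ->
  forall t i w, (i + t = k)%N -> w \in L i ->
  (live_config N1 tau1 X1 t).1 w = (live_config N2 tau2 X2 t).1 w.
Proof.
move=> eqF sX1 sX2 back1 back2 eqX eqS seedless1.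
have seedless2 i w : (i < k)%N -> w \in L i -> seeded tau2 w = set0.
  by move=> lt_k wL; rewrite -(eqS i w) ?(ltnW lt_k) //; apply: seedless1 wL.
elim=> [|t IHt] i w eq_k wL.
  by rewrite /= !ffunE eqF (eqS i) //; lia.
rewrite !live_configS !ffunE.
rewrite (live_inactive sX1 back1 seedless1 (t := t) _ wL); last by lia.
rewrite (live_inactive sX2 back2 seedless2 (t := t) _ wL); last by lia.
rewrite (live_activators sX1 back1 seedless1 eq_k wL).
rewrite (live_activators sX2 back2 seedless2 eq_k wL).
have IH u : u \in L i.+1 ->
    (live_config N1 tau1 X1 t).1 u = (live_config N2 tau2 X2 t).1 u.
  by apply: IHt; lia.
set A1 := [set u in _ | _]; set A2 := [set u in _ | _].
have eqA : A1 = A2.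
  apply/setP => u; rewrite !inE; case uL: (u \in _) => //=.
  by rewrite IH // (eqX i u w) //; lia.
rewrite -eqA -eqF; case: ifP => // _; congr (Some (actf N1 w _)).
apply/setP => -[u c]; rewrite [LHS]inE [RHS]inE /=.
by case uA: (u \in A1) => //=; rewrite IH //; move: uA; rewrite inE => /and3P[].
Qed.

(** * Backward breadth-first layers of a node *)

Section Layering.
Variables (V : finType) (X : {set V * V}) (v : V).

Definition into (W L : {set V}) : {set V * V} :=
  [set e : V * V | (e.1 \in ~: W) && (e.2 \in L)].

Fixpoint bfs (i : nat) : {set V} * {set V} :=
  if i is i'.+1 then
    let L := [set e.1 | e in X :&: into (bfs i').1 (bfs i').2] in
    ((bfs i').1 :|: L, L)
  else ([set v], [set v]).

Definition ball i := (bfs i).1.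
Definition layer i := (bfs i).2.

Lemma ballS i : ball i.+1 = ball i :|: layer i.+1.
Proof. by []. Qed.

Lemma ballE i : ball i = \bigcup_(j < i.+1) layer j.
Proof.
elim: i => [|i IHi]; first by rewrite big_ord_recr big_ord0 /= set0U.
by rewrite ballS IHi [RHS]big_ord_recr.
Qed.

Lemma layerSP i u : reflect
  [/\ u \notin ball i & exists2 w, w \in layer i & (u, w) \in X]
  (u \in layer i.+1).
Proof.
apply: (iffP imsetP) => [[[u' w]]|[ui [w wL uw]]].
  by rewrite !inE /= => /and3P[uw ui wL] ->; split=> //; exists w.
by exists (u, w); rewrite // !inE /= uw ui.
Qed.

Lemma layer_back j u w : w \in layer j -> (u, w) \in X ->
  exists2 i, (i <= j.+1)%N & u \in layer i.
Proof.
move=> wL uw; have [|ui] := boolP (u \in ball j); last first.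
  by exists j.+1 => //; apply/layerSP; split=> //; exists w.
by rewrite ballE => /bigcupP[i _ ui]; exists (i : nat); rewrite // ltnW.
Qed.

End Layering.

(** * RR-tuples as explorations of the live edges *)

Section ReverseReachability.
Variables (R : realFieldType) (V Ce : finType) (M : mim R V Ce).
Implicit Types (x : rrtuple V * {set V}) (D X : {set V * V}).

(** The state pairs the tuple with the frontier [V_t]. A return empties the frontier, after which
    rounds query nothing, so a fixed number of rounds accommodates early returns. *)
Definition rr_query x : {set V * V} :=
  if x.2 :&: tau_star M != set0 then set0
  else [set e in edges M | (e.1 \in ~: rrV x.1) && (e.2 \in x.2)].

Definition rr_next x X : rrtuple V * {set V} :=
  let: RRtuple VG EG Slo Sup := x.1 in
  if x.2 :&: tau_star M != set0 then (RRtuple VG EG Slo (Sup :|: x.2), set0)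
  else let Vt := [set e.1 | e in X] in
    (RRtuple (VG :|: Vt) (EG :|: X) (Slo :|: x.2) (Sup :|: x.2), Vt).

Definition rr_inv x D : Prop :=
  x.2 \subset rrV x.1 /\
  forall e, e \in edges M -> e.1 \notin rrV x.1 ->
    (e.2 \in x.2) || (e.2 \notin rrV x.1) -> e \in D.

Lemma rr_inv_query x D : rr_inv x D -> rr_query x \subset D.
Proof.
case=> _ xD; rewrite /rr_query; case: ifP => _; first exact: sub0set.
apply/subsetP => e; rewrite !inE => /and3P[eE e1 e2].
by apply: xD; rewrite ?e2.
Qed.

(** A queried edge has its head in the frontier, hence in [V(G_v)], whereas later frontiers consist
    of nodes outside it. *)
Lemma rr_inv_next x D X : rr_inv x D -> X \subset rr_query x ->
  rr_inv (rr_next x X) (D :\: rr_query x).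
Proof.
case: x => [[VG EG Slo Sup] Vt] [/= sVt xD]; rewrite /rr_query /rr_next /=.
case: ifP => _ sX; split=> /=; first exact: sub0set.
- by move=> e eE e1 e2; rewrite setD0 xD // ; move: e2; rewrite inE => /= ->; rewrite orbT.
- exact: subsetUr.
move=> e eE; rewrite !inE negb_or => /andP[e1 _] e2.
have {}e2 : e.2 \notin VG.
  case/orP: e2 => [/imsetP[e' /(subsetP sX) + ->]|].
    by rewrite !inE => /and3P[].
  by rewrite negb_or => /andP[].
rewrite eE e1 xD ?e2 ?orbT // andbT /=.
by apply: contra e2; apply: (subsetP sVt).
Qed.

Lemma sum_reveal_set0 (p : V * V -> R) x (a : R) (F : rrtuple V * {set V} -> R) :
  rr_query x = set0 -> F (rr_next x set0) = a ->
  reveal p rr_query rr_next F x = a.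
Proof.
move=> q0 <-; rewrite /reveal q0 (bigD1 set0) //= big1 ?addr0.
  by rewrite ffunE subxx big_set0 setDv big_set0 !mul1r.
by move=> X nX; rewrite ffunE subset0 (negPf nX) mul0r.
Qed.

Lemma iter_reveal_stopped n r h :
  iter n (reveal (pprob M) rr_query rr_next) h (r, set0) = h (r, set0).
Proof.
elim: n => //= n IHn; apply: sum_reveal_set0; last first.
  by case: r IHn => *; rewrite /rr_next /= set0I eqxx /= imset0 !setU0.
rewrite /rr_query /= set0I eqxx; apply/setP => e.
by rewrite !inE !andbF.
Qed.

Lemma expect_rr_loop n VG EG Vt Slo Sup h :
  expect (rr_loop M n VG EG Vt Slo Sup) h =
  iter n (reveal (pprob M) rr_query rr_next) (fun x => h x.1)
    (RRtuple VG EG Slo Sup, Vt).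
Proof.
elim: n VG EG Vt Slo Sup => [|n IHn] VG EG Vt Slo Sup; first exact: expect_ret.
rewrite /=; case: eqVneq => [->|_].
  by rewrite expect_ret -iterS iter_reveal_stopped.
case: ifP => hit.
  rewrite expect_ret; apply/esym/sum_reveal_set0; rewrite ?/rr_query ?/rr_next /= hit //.
  by rewrite iter_reveal_stopped.
rewrite expect_bind /reveal /rr_query /= hit; apply: eq_bigr => X _.
by rewrite IHn /rr_next /= hit.
Qed.

Definition live_rr v X : rrtuple V :=
  (iter #|V|.+1 (live_step rr_query rr_next X)
     (RRtuple [set v] set0 set0 set0, [set v])).1.

Lemma expect_rr_law v h :
  expect (rr_law M v) h =
  \sum_X coins (pprob M) (edges M) X * h (live_rr v X).
Proof.
rewrite expect_rr_loop.
by rewrite (iter_reveal (pprob M) rr_inv_query rr_inv_next _ _ (D := edges M)).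
Qed.

(* [d] is the number of completed rounds; the second disjunct is the return   *)
(* on a seed of an existing cascade. When [layer X v i] is empty the loop     *)
(* has returned, but [rr_next] then changes nothing but the round count.      *)
Lemma live_rr_iter v X i : X \subset edges M ->
  let x := iter i (live_step rr_query rr_next X)
             (RRtuple [set v] set0 set0 set0, [set v]) in
  exists2 d, (d <= i)%N & [/\
    forall j, (j < d)%N -> layer X v j :&: tau_star M = set0,
    rrV x.1 = ball X v d,
    rrE x.1 = \bigcup_(j < d) (X :&: into (ball X v j) (layer X v j)),
    rr_lower x.1 = \bigcup_(j < d) layer X v j &
      [/\ d = i, x.2 = layer X v d & rr_upper x.1 = \bigcup_(j < d) layer X v j]
      \/ [/\ (d < i)%N, x.2 = set0, layer X v d :&: tau_star M != set0
           & rr_upper x.1 = \bigcup_(j < d.+1) layer X v j]].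
Proof.
move=> sX; elim: i => [|i]; first by exists 0 => //=; split; rewrite ?big_ord0 //; left.
rewrite iterS; set x := iter i _ _.
case: x => -[VG EG Slo Sup] Vt /= [d le_d [miss -> -> -> out]].
rewrite /live_step /rr_next /rr_query /=.
case: out => [[eq_d -> ->]|[lt_d -> hit ->]]; last first.
  exists d; first exact: leq_trans le_d _.
  rewrite set0I eqxx /=.
  have -> : X :&: [set e in edges M | (e.1 \in ~: ball X v d) && (e.2 \in set0)] = set0.
    by apply/setP => e; rewrite !inE !andbF.
  by rewrite imset0 !setU0; split=> //; right; split=> //; apply: leqW.
case: ifPn => [hit|/negPn/eqP nhit].
  exists d; first exact: leqW.
  split=> //=; right; split=> //.
  by rewrite [RHS]big_ord_recr.
rewrite nhit eqxx /=.
have -> : X :&: [set e in edges M | (e.1 \in ~: ball X v d) && (e.2 \in layer X v d)]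
        = X :&: into (ball X v d) (layer X v d).
  apply/setP => e; rewrite !inE; case eX: (e \in X) => //=.
  by rewrite (subsetP sX).
exists d.+1; first by rewrite eq_d.
split=> /=.
- by move=> j; rewrite ltnS leq_eqVlt => /predU1P[-> //|/miss].
- by [].
- by rewrite [RHS]big_ord_recr.
- by rewrite [RHS]big_ord_recr.
by left; rewrite eq_d; split=> //; rewrite [RHS]big_ord_recr.
Qed.

Lemma live_rrP v X : X \subset edges M ->
  let r := live_rr v X in
  exists2 d, (d <= #|V|.+1)%N & [/\
    forall j, (j < d)%N -> layer X v j :&: tau_star M = set0,
    (d <= #|V|)%N -> layer X v d :&: tau_star M != set0,
    rrE r = \bigcup_(j < d) (X :&: into (ball X v j) (layer X v j)),
    rr_lower r = \bigcup_(j < d) layer X v j &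
    forall j, (j <= d)%N -> (j <= #|V|)%N ->
      layer X v j \subset rrV r /\ layer X v j \subset rr_upper r].
Proof.
move=> sX /=; have [d le_d [miss eV eE eL out]] := live_rr_iter v #|V|.+1 sX.
exists d => //; split=> //.
  by case: out => [[-> _ _]|[_ _ ->]] //; rewrite ltnn.
move=> j le_j le_jV; rewrite eV ballE; split.
  exact: (bigcup_sup (Ordinal (le_j : j < d.+1)%N)).
(* Without a hit, [d] is [#|V|.+1], so the layers below [d] already include every [j] up to
   [#|V|]. *)
case: out => [[eq_d _ ->]|[_ _ _ ->]]; last first.
  exact: (bigcup_sup (Ordinal (le_j : j < d.+1)%N)).
have lt_j : (j < d)%N by rewrite eq_d.
exact: (bigcup_sup (Ordinal lt_j)).
Qed.

End ReverseReachability.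

(** * Comparison of the estimators for fixed live edges *)

Section LiveInstance.
Variables (R : realFieldType) (V Ce : finType) (M : mim R V Ce).
Hypothesis actM : actf_valid M.
Variables (v : V) (S : {set V}) (X : {set V * V}).
Hypothesis sub_edges : X \subset edges M.

Let r := live_rr M v X.
Let wins := cnew_active v (live_config M (seeding M S) X #|V|).

Lemma g_live : g M v S r =
  (cnew_active v (live_config (mim_of_rr M r)
     (seeding (mim_of_rr M r) (S :&: rrV r)) (rrE r) #|V|))%:R.
Proof.
rewrite g_deterministic /f prob_final /= coins1 (bigD1 (rrE r)) //=.
rewrite ffunE eqxx mul1r big1 ?addr0 // => Y nY.
by rewrite ffunE eq_sym (negPf nY) mul0r.
Qed.

Lemma seeded_tau_star w i : w \in eseeds M i -> w \in tau_star M.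
Proof. by move=> wi; apply/bigcupP; exists i. Qed.

Lemma live_estimates :
  [/\ g M v S r = wins%:R, g_lower R S r <= wins%:R & wins%:R <= g_upper R S r].
Proof.
rewrite g_live /wins /cnew_active.
have [d le_d [miss hit eE eL sub]] := live_rrP v sub_edges.
rewrite -/r in eE eL sub.
pose tau := seeding M S.
(* Capping at [#|V|] makes [k] exist even if no layer contains a seed. *)
pose P i := (i == #|V|) || [exists u in layer X v i, seeded tau u != set0].
have exP : exists i, P i by exists #|V|; rewrite /P eqxx.
have [k Pk min_k] := ex_minnP exP.
have le_kV : (k <= #|V|)%N by apply: min_k; rewrite /P eqxx.
have le_kd : (k <= d)%N.
  have [/hit/set0Pn[u]|] := leqP d #|V|; last by move=> /ltnW; apply: leq_trans.
  rewrite inE => /andP[uL /bigcupP[i _ ui]]; apply: min_k; apply/orP; right.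
  apply/existsP; exists u; rewrite uL; apply/set0Pn; exists (Some i).
  by rewrite inE.
have seedless i w : (i < k)%N -> w \in layer X v i -> seeded tau w = set0.
  move=> lt_i wL; apply/eqP; apply: contraTT lt_i => nw; rewrite -leqNgt.
  by apply: min_k; apply/orP; right; apply/existsP; exists w; rewrite wL.
have back j u w : (j < k)%N -> w \in layer X v j -> (u, w) \in X ->
    exists2 i, (i <= j.+1)%N & u \in layer X v i.
  by move=> _; apply: layer_back.
have v0 : v \in layer X v 0 by rewrite inE.
have sEX : rrE r \subset X.
  by rewrite eE; apply/bigcupsP => j _; apply: subsetIl.
have eqk : (live_config M tau X k).1 v =
    (live_config (mim_of_rr M r) (seeding (mim_of_rr M r) (S :&: rrV r)) (rrE r) k).1 v.
  apply: (live_eq (L := layer X v) (k := k) _ _ _ back _ _ _ seedless (i := 0)) => //.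
  - by move=> j u w lt_j wL /(subsetP sEX); apply: back wL.
  - move=> j u w lt_j wL /layerSP[uj _]; apply/idP/idP; last exact: (subsetP sEX).
    move=> uw; rewrite eE; apply/bigcupP.
    exists (Ordinal (leq_trans lt_j le_kd)) => //.
    by rewrite !inE uw wL uj.
  move=> i w le_i wL; apply/setP => c; rewrite !inE.
  have [|sV _] := sub i (leq_trans le_i le_kd); first exact: leq_trans le_i _.
  have wV := subsetP sV _ wL.
  by case: c => [c|] /=; rewrite !inE wV ?andbT.
have reach u : u \in layer X v k -> seeded tau u != set0 ->
    (live_config M tau X k).1 v != None.
  move=> uL nu; apply: (live_reach sub_edges back seedless (i := k) _ _ (t := 0) (u := u)) => //.
  - by move=> j u' _ /layerSP[_].
  - exact: addn0.
  by rewrite ffunE (negPf nu).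
have stable : k = #|V| \/ (live_config M tau X k).1 v != None.
  case/orP: Pk => [/eqP|/existsP[u /andP[uL nu]]]; first by left.
  by right; apply: reach nu.
have eqA : (live_config M tau X #|V|).1 v = (live_config M tau X k).1 v.
  by case: stable => [-> //|nv]; apply: live_config_persist.
have source c : (live_config M tau X k).1 v = Some c ->
    exists2 u, u \in layer X v k & u \in tau c.
  by apply: (live_source sub_edges back seedless actM (i := 0)).
rewrite -/tau eqA; split.
- congr (_ == _)%:R; case: stable => [kV|nv]; first by rewrite -kV eqk.
  by rewrite eqk; apply: live_config_persist; rewrite // -eqk.
- rewrite /g_lower; case: set0Pn => [[u]|_]; last by rewrite ler0n.
  rewrite inE eL => /andP[uS /bigcupP[i _ uL]].
  have nu : seeded tau u != set0 by apply/set0Pn; exists None; rewrite inE.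
  have le_ki : (k <= i)%N.
    by apply: min_k; apply/orP; right; apply/existsP; exists u; rewrite uL.
  have nv : (live_config M tau X k).1 v != None.
    (* If [k] is the cap, [k <= i < d <= #|V|.+1] forces [i = k], so [u] itself is a seed in layer
       [k]. *)
    case/orP: Pk => [/eqP kV|/existsP[u' /andP[u'L nu']]]; last exact: reach nu'.
    apply: reach nu; suff -> : k = i by [].
    by apply/eqP; rewrite eqn_leq le_ki kV; have := ltn_ord i; lia.
  (* Were an existing cascade to win, it would have a seed in layer [k], but [k <= i < d] and the
     layers before [d] avoid [tau_star]. *)
  case E: ((live_config M tau X k).1 v) nv => [[i'|]|] // _.
  have [w wL wi'] := source _ E.
  have := miss k (leq_ltn_trans le_ki (ltn_ord i)).
  by move/setP/(_ w); rewrite !inE wL (seeded_tau_star wi').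
case: eqP => [/source[u uL uS]|_]; last by rewrite ler0n.
have [_ /subsetP/(_ _ uL) uU] := sub k le_kd le_kV.
have nSU : S :&: rr_upper r != set0.
  by apply/set0Pn; exists u; rewrite inE uU andbT.
by rewrite /g_upper nSU.
Qed.

End LiveInstance.

Theorem theorem2 (R : realFieldType) (V Ce : finType) (M : mim R V Ce)
    (hM : mim_valid M) (v : V) (S : {set V}) :
  [/\ expect (rr_law M v) (g_lower R S) <= expect (rr_law M v) (g M v S),
      expect (rr_law M v) (g M v S) = f M v S
    & f M v S <= expect (rr_law M v) (g_upper R S)].
Proof.
case: hM => pM actM.
have p_ge0 X : 0 <= coins (pprob M) (edges M) X.
  by apply: coins_ge0 => e /pM/andP[/ltW-> ->].
have live (h1 h2 : {set V * V} -> R) :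
    (forall X : {set V * V}, X \subset edges M -> h1 X <= h2 X) ->
    \sum_X coins (pprob M) (edges M) X * h1 X <=
    \sum_X coins (pprob M) (edges M) X * h2 X.
  move=> le12; apply: ler_sum => X _.
  have [->|/coins_supp sX] := eqVneq (coins (pprob M) (edges M) X) 0.
    by rewrite !mul0r.
  exact: ler_wpM2l (p_ge0 X) _ _ (le12 X sX).
rewrite /f prob_final !expect_rr_law; split.
- by apply: live => X /(live_estimates actM v S)[-> ].
(* Two inequalities, because [live] supplies the restriction to [X \subset edges M] under which the
   pointwise equality holds. *)
- by apply/eqP; rewrite eq_le !live // => X /(live_estimates actM v S)[->].
by apply: live => X /(live_estimates actM v S)[].
Qed.
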